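(* The class of generalized weakly-Weyl Finsler metrics is closed under projective changes. That is, let $M$ be a smooth manifold of dimension $n\ge2$ and let $F$ and $\bar F$ be projectively equivalent Finsler metrics on $M$. If $\bar F$ is a generalized weakly-Weyl Finsler metric, then $F$ is a generalized weakly-Weyl Finsler metric.
   Context: Let $F$ be a Finsler metric on an $n$-dimensional manifold $M$ with standard local coordinates $(x^i,y^i)$ on $TM$; all tensors below live on $TM\setminus\{0\}$. A subscript ''$._k$'' denotes $\partial/\partial y^k$. The spray coefficients are $G^i=\frac14 g^{il}\{(F^2)_{x^ky^l}y^k-(F^2)_{x^l}\}$, where $g_{ij}=\frac12(F^2)_{y^iy^j}$. Two Finsler metrics $F,\bar F$ on $M$ are projectively equivalent if $G^i=\bar G^i+Py^i$ for some function $P=P(x,y)$ positively homogeneous of degree one in $y$. A subscript ''$|_m$'' denotes the horizontal covariant derivative of the Berwald connection of $F$; e.g. with $N^r{}_m=G^r{}_{.m}$ and $G^i{}_{rm}=G^i{}_{.r.m}$, $T^i{}_{j|m}=\partial_{x^m}T^i{}_j-N^r{}_mT^i{}_{j.r}+G^i{}_{rm}T^r{}_j-G^r{}_{jm}T^i{}_r$, and similarly for other tensors. The subscript $0$ denotes contraction with $y$, e.g. $T_{|0}=T_{|m}y^m$. Riemann curvature: $R^i{}_k=2\frac{\partial G^i}{\partial x^k}-\frac{\partial^2G^i}{\partial x^m\partial y^k}y^m+2G^m\frac{\partial^2G^i}{\partial y^m\partial y^k}-\frac{\partial G^i}{\partial y^m}\frac{\partial G^m}{\partial y^k}$. Weyl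 curvature: $W^i{}_k=A^i{}_k-\frac1{n+1}A^m{}_{k.m}y^i$, where $A^i{}_k=R^i{}_k-R\,\delta^i{}_k$ and $R=\frac1{n-1}R^m{}_m$. Set $W_j{}^i{}_{pl}=\frac13\big(W^i{}_{p.l}-W^i{}_{l.p}\big)_{.j}$. Weakly-Weyl curvature: $\tilde W_j{}^i{}_{kl}=W_j{}^i{}_{pl.k}\,y^p$. $F$ is a generalized weakly-Weyl Finsler metric if there exist a tensor $\lambda_r=\lambda_r(x,y)$ and a smooth scalar function $\mu$ on $TM\setminus\{0\}$ such that $\tilde W_j{}^i{}_{kl|0}+\mu F\,\tilde W_j{}^i{}_{kl}=\lambda_r\tilde W_j{}^r{}_{kl}\,y^i$. *)

(* Defs.v *)
From HB Require Import structures.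
From mathcomp Require Import all_boot all_order all_algebra.
From mathcomp Require Import all_classical all_reals all_analysis.

Set Implicit Arguments.
Unset Strict Implicit.
Unset Printing Implicit Defensive.

Import Order.TTheory GRing.Theory Num.Theory.
Import numFieldNormedType.Exports.

Local Open Scope classical_set_scope.
Local Open Scope ring_scope.

(* For a finite-dimensional V and an open U this is the usual notion of a C^k
   map on U: in that case f is C^(k+1) iff it is differentiable on U and all
   its directional derivatives are C^k on U.  Only the germs of f at the points
   of U matter; the values of f outside of U are irrelevant. *)
Fixpoint Ck (R : realType) (V W : normedModType R) (k : nat) (U : set V)
    (f : V -> W) : Prop :=
  if k is k'.+1 then
    (forall x, U x -> differentiable f x) /\ (forall v, Ck k' U ('D_v f))
  else forall x, U x -> {for x, continuous f}.

Definition smooth_on (R : realType) (V W : normedModType R) (U : set V)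
    (f : V -> W) : Prop := forall k, Ck k U f.

(* An n-dimensional smooth structure on M, given by an atlas.  [phi c] and
   [psi c] are total functions, but only their values on [dom c] and on its
   image are meaningful.  An n-dimensional smooth manifold is a Hausdorff second
   countable space with such an atlas; maximality is not needed, since every
   notion below is independent of the atlas chosen for the smooth structure. *)
Record smooth_atlas (R : realType) (n : nat) (M : topologicalType) :=
  SmoothAtlas {
    chart : Type;
    dom : chart -> set M;
    phi : chart -> M -> 'rV[R]_n;
    psi : chart -> 'rV[R]_n -> M;
    dom_open : forall c, open (dom c);
    dom_cover : forall m, exists c, dom c m;
    img_open : forall c, open (phi c @` dom c);
    phiK : forall c m, dom c m -> psi c (phi c m) = m;
    phi_continuous : forall c m, dom c m -> {for m, continuous (phi c)};
    psi_continuous : forall c x, (phi c @` dom c) x ->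
      {for x, continuous (psi c)};
    transition_smooth : forall c d,
      smooth_on (phi c @` (dom c `&` dom d)) (phi d \o psi c)
  }.

(* A point (x, y) of ['rV_n * 'rV_n] stands for the tangent vector with
   standard local coordinates (x^i, y^i) in a given chart. *)
Definition coordTM (R : realType) (n : nat) : normedModType R :=
  ('rV[R]_n * 'rV[R]_n)%type.

Definition ycoord (R : realType) (n : nat) (i : 'I_n) (p : coordTM R n) : R :=
  p.2 0 i.

Section Charts.
Context (R : realType) (n : nat) (M : topologicalType).
Context (A : smooth_atlas R n M).

(* the part of TM (resp. of TM minus the zero section) over a chart domain *)
Definition tangent (c : chart A) : set (coordTM R n) :=
  [set p | (phi c @` dom c) p.1].

Definition slit (c : chart A) : set (coordTM R n) :=
  [set p | (phi c @` dom c) p.1 /\ p.2 != 0].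

Definition transition (c d : chart A) : 'rV[R]_n -> 'rV[R]_n :=
  phi d \o psi c.

Definition overlap (c d : chart A) : set (coordTM R n) :=
  [set p | (phi c @` (dom c `&` dom d)) p.1].

(* change of the standard local coordinates of TM: y'^s = y^r dx'^s/dx^r *)
Definition change (c d : chart A) (p : coordTM R n) : coordTM R n :=
  (transition c d p.1, 'D_(p.2) (transition c d) p.1).

(* the matrix entry dx'^s/dx^r *)
Definition jac (c d : chart A) (r s : 'I_n) (p : coordTM R n) : R :=
  'D_(delta_mx 0 r) (transition c d) p.1 0 s.

(* Functions and tensors on TM \ 0 are given by their local expressions. *)
Definition scalar_on_slit (f : chart A -> coordTM R n -> R) : Prop :=
  forall c d p, slit c p -> overlap c d p -> f d (change c d p) = f c p.

Definition smooth_on_slit (f : chart A -> coordTM R n -> R) : Prop :=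
  forall c, smooth_on (slit c) (f c).

Definition covector_on_slit (l : chart A -> 'I_n -> coordTM R n -> R) : Prop :=
  forall c d p, slit c p -> overlap c d p ->
    forall r, l c r p = \sum_(s < n) jac c d r s p * l d s (change c d p).

End Charts.

Section LocalFormulas.
Context (R : realType) (n : nat).
Implicit Types (f : coordTM R n -> R) (F : coordTM R n -> R).

Definition dx (i : 'I_n) f : coordTM R n -> R :=
  'D_((delta_mx 0 i, 0) : coordTM R n) f.

Definition dy (i : 'I_n) f : coordTM R n -> R :=
  'D_((0, delta_mx 0 i) : coordTM R n) f.

Definition fundamental F (p : coordTM R n) : 'M[R]_n :=
  \matrix_(i, j) (2^-1 * dy j (dy i (fun q => F q ^+ 2)) p).

Definition spray F (i : 'I_n) (p : coordTM R n) : R :=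
  4^-1 * \sum_(l < n) invmx (fundamental F p) i l *
    ((\sum_(k < n) dy l (dx k (fun q => F q ^+ 2)) p * ycoord k p)
     - dx l (fun q => F q ^+ 2) p).

(* In the component functions below, the arguments are the indices in reading
   order: [riemann F i k] is R^i_k, [weyl4 F j i p l] is W_j^i_pl and
   [hcov F T j i k l m] is T_j^i_kl|m (Berwald connection of F).  [scalarR] is
   R = R^m_m / (n - 1). *)
Definition riemann F (i k : 'I_n) (p : coordTM R n) : R :=
  2 * dx k (spray F i) p
  - \sum_(m < n) dx m (dy k (spray F i)) p * ycoord m p
  + 2 * \sum_(m < n) spray F m p * dy m (dy k (spray F i)) p
  - \sum_(m < n) dy m (spray F i) p * dy k (spray F m) p.

Definition scalarR F (p : coordTM R n) : R :=
  (n%:R - 1)^-1 * \sum_(m < n) riemann F m m p.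

Definition tensorA F (i k : 'I_n) (p : coordTM R n) : R :=
  riemann F i k p - scalarR F p * (i == k)%:R.

Definition weyl F (i k : 'I_n) (p : coordTM R n) : R :=
  tensorA F i k p
  - (n%:R + 1)^-1 * (\sum_(m < n) dy m (tensorA F m k) p) * ycoord i p.

Definition weyl4 F (j i p l : 'I_n) : coordTM R n -> R :=
  dy j (fun q => 3^-1 * (dy l (weyl F i p) q - dy p (weyl F i l) q)).

Definition weakly_weyl F (j i k l : 'I_n) (q : coordTM R n) : R :=
  \sum_(p < n) dy k (weyl4 F j i p l) q * ycoord p q.

Definition berwaldN F (r m : 'I_n) : coordTM R n -> R := dy m (spray F r).

Definition berwaldG F (i r m : 'I_n) : coordTM R n -> R :=
  dy m (dy r (spray F i)).

Definition hcov F (T : 'I_n -> 'I_n -> 'I_n -> 'I_n -> coordTM R n -> R)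
    (j i k l m : 'I_n) (q : coordTM R n) : R :=
  dx m (T j i k l) q
  - \sum_(r < n) berwaldN F r m q * dy r (T j i k l) q
  + \sum_(r < n) berwaldG F i r m q * T j r k l q
  - \sum_(r < n) berwaldG F r j m q * T r i k l q
  - \sum_(r < n) berwaldG F r k m q * T j i r l q
  - \sum_(r < n) berwaldG F r l m q * T j i k r q.

Definition hcov0 F (T : 'I_n -> 'I_n -> 'I_n -> 'I_n -> coordTM R n -> R)
    (j i k l : 'I_n) (q : coordTM R n) : R :=
  \sum_(m < n) hcov F T j i k l m q * ycoord m q.

End LocalFormulas.

Section Finsler.
Context (R : realType) (n : nat) (M : topologicalType).
Context (A : smooth_atlas R n M).

Record finsler_metric := FinslerMetric {
  metric :> chart A -> coordTM R n -> R;
  metric_scalar : forall c d p, tangent c p -> overlap c d p ->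
    metric d (change c d p) = metric c p;
  metric_ge0 : forall c p, tangent c p -> 0 <= metric c p;
  metric_smooth : smooth_on_slit metric;
  metric_homogeneous : forall c (x y : 'rV[R]_n) (t : R), tangent c (x, y) ->
    0 < t -> metric c (x, t *: y) = t * metric c (x, y);
  metric_convex : forall c p, slit c p -> forall v : 'rV[R]_n, v != 0 ->
    0 < (v *m fundamental (metric c) p *m v^T) 0 0
}.

Definition projectively_equivalent (F Fbar : finsler_metric) : Prop :=
  exists P : chart A -> coordTM R n -> R,
    [/\ scalar_on_slit P,
        (forall c (x y : 'rV[R]_n) (t : R), slit c (x, y) -> 0 < t ->
           P c (x, t *: y) = t * P c (x, y))
      & forall c p, slit c p -> forall i,
          spray (F c) i p = spray (Fbar c) i p + P c p * ycoord i p].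

Definition generalized_weakly_weyl (F : finsler_metric) : Prop :=
  exists (lambda : chart A -> 'I_n -> coordTM R n -> R)
         (mu : chart A -> coordTM R n -> R),
    [/\ covector_on_slit lambda,
        (forall r, smooth_on_slit (fun c => lambda c r)),
        scalar_on_slit mu,
        smooth_on_slit mu
      & forall c p, slit c p -> forall j i k l,
          hcov0 (F c) (weakly_weyl (F c)) j i k l p
          + mu c p * F c p * weakly_weyl (F c) j i k l p
          = \sum_(r < n) lambda c r p * weakly_weyl (F c) j r k l p
            * ycoord i p].

End Finsler.

(* Main.v *)
(* Let G^i = Gb^i + P y^i be the two sprays.  Expanding the definition of the
   Riemann curvature and using Euler's identity for the homogeneous functions
   Gb^i, P and their y-derivatives gives
     R^i_k = Rb^i_k + Xi delta^i_k + tau_k y^i,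
   where tau is homogeneous of degree 1 and tau_m y^m = - Xi.  Hence R = Rb + Xi
   and A^i_k = Ab^i_k + tau_k y^i, so the Weyl curvature is the same for F and Fb,
   and so is the weakly-Weyl curvature T.  Since T is homogeneous of degree 0 in y
   and its contraction with y in each lower index vanishes, comparing the two
   Berwald connections yields
     T_j^i_kl|0 = T_j^i_kl||0 - 2 P T_j^i_kl + P_.r T_j^r_kl y^i,
   with || for Fb.  So F satisfies the required equation with
     mu = (mub Fb + 2 P) / F  and  lambda_r = lambdab_r + P_.r. *)

From HB Require Import structures.
Require Import Defs.
From mathcomp Require Import all_boot all_order all_algebra.
From mathcomp Require Import all_classical all_reals all_analysis.
From mathcomp Require Import ring.

Set Implicit Arguments.
Unset Strict Implicit.
Unset Printing Implicit Defensive.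

Import Order.TTheory GRing.Theory Num.Theory.
Import numFieldNormedType.Exports.

Local Open Scope classical_set_scope.
Local Open Scope ring_scope.

(** * Calculus of smooth functions *)

(** The zero map serves as differential, because the remainder vanishes identically near [x]. Germ
    invariance of differentiability reduces to this case. *)
Lemma near0_differentiable (R : realType) (V W : normedModType R) (h : V -> W) x :
  (\near x, h x = 0) -> differentiable h x.
Proof.
move=> hx0; have h0 : h x = 0 by exact: nbhs_singleton hx0.
have hs : \forall y \near (0 : V), h (y + x) = 0.
  by rewrite (near_shift x)/=; near do rewrite /= sub0r addrNK//.
have hd : h \o shift x = cst (h x) + (\0 : V -> W) +o_ 0 id.
  apply/eqaddoP => _/posnumP[e] /=; near=> y.
  rewrite [X in `|X|](_ : _ = h (y + x)); last first.
    by rewrite !fctE h0 /= addr0 subr0.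
  have -> : h (y + x) = 0 by near: y.
  by rewrite normr0 mulr_ge0.
by apply/diff_locallyP; split; rewrite (diff_unique _ hd) //; exact: cst_continuous.
Unshelve. all: by end_near. Qed.

Lemma near_eq_differentiable (R : realType) (V W : normedModType R)
    (f g : V -> W) x :
  (\near x, f x = g x) -> differentiable f x -> differentiable g x.
Proof.
move=> fg df; rewrite (_ : g = f + (g - f)); last by rewrite addrC subrK.
apply: differentiableD => //; apply: near0_differentiable.
by near=> y; rewrite !fctE (near fg) ?subrr.
Unshelve. all: by end_near. Qed.

Section SmoothCalculus.
Context (R : realType) (V : normedModType R) (U : set V).
Implicit Types f g : V -> R.

Lemma smooth_differentiable f p : smooth_on U f -> U p -> differentiable f p.
Proof. by move=> /(_ 1) [+ _]; exact. Qed.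

Lemma smooth_derivable f p v : smooth_on U f -> U p -> derivable f p v.
Proof. by move=> sf Up; apply/diff_derivable/(smooth_differentiable sf). Qed.

Lemma smooth_derive f v : smooth_on U f -> smooth_on U ('D_v f).
Proof. by move=> sf k; have [_] := sf k.+1; exact. Qed.

Lemma CkW k f : Ck k.+1 U f -> Ck k U f.
Proof.
elim: k f => [|k IH] f [df sf]; first by move=> x /df; exact: differentiable_continuous.
by split=> // v; exact: IH.
Qed.

Lemma smooth_cst (a : R) : smooth_on U (fun=> a).
Proof.
move=> k; elim: k a => [|k IH] a; first by move=> x _; exact: cst_continuous.
split=> [x _|v]; first exact: differentiable_cst.
rewrite (_ : 'D_v (fun=> a) = (fun=> 0 : R)) //.
by apply/funext => x; rewrite derive_cst.
Qed.

Lemma smooth_linear (f : {linear V -> R}) : continuous f -> smooth_on U f.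
Proof.
move=> cf [|k]; first by move=> x _; exact: cf.
split=> [x _|v]; first exact: linear_differentiable.
rewrite (_ : 'D_v f = cst (f v)); last first.
  apply/funext => x; rewrite deriveE; last exact: linear_differentiable.
  by rewrite diff_lin.
exact: smooth_cst.
Qed.

Hypothesis openU : open U.

Lemma derive_eq_on (W : normedModType R) (f g : V -> W) v p :
  (forall q, U q -> f q = g q) -> U p -> 'D_v f p = 'D_v g p.
Proof.
move=> fg Up; apply: near_eq_derive; near=> q; apply: fg.
by near: q; exact: open_nbhs_nbhs.
Unshelve. all: by end_near. Qed.

(** Openness of [U] makes the directional derivatives of [f] and [g] agree on [U] as well, so the
    induction passes to them. Hence a derivative may be replaced by a formula valid only on [U]. *)
Lemma eq_Ck k f g : (forall q, U q -> f q = g q) -> Ck k U f -> Ck k U g.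
Proof.
elim: k f g => [|k IH] f g fg.
  move=> cf x Ux; have cfx : f @ x --> f x := cf _ Ux.
  rewrite /prop_for /continuous_at -(fg _ Ux).
  apply: cvg_trans cfx; apply: near_eq_cvg; near=> y; rewrite fg//.
  by near: y; exact: open_nbhs_nbhs.
move=> [df sf]; split=> [x Ux|v].
  apply: near_eq_differentiable (df _ Ux); near=> y; rewrite fg//.
  by near: y; exact: open_nbhs_nbhs.
by apply: (IH _ _ _ (sf v)) => q; exact: derive_eq_on.
Unshelve. all: by end_near. Qed.

Lemma eq_smooth f g : (forall q, U q -> f q = g q) -> smooth_on U f -> smooth_on U g.
Proof. by move=> fg sf k; exact: eq_Ck (sf k). Qed.

Lemma CkD k f g : Ck k U f -> Ck k U g -> Ck k U (fun q => f q + g q).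
Proof.
elim: k f g => [|k IH] f g.
  by move=> cf cg x Ux; exact: (continuousD (cf _ Ux) (cg _ Ux)).
move=> [df sf] [dg sg]; split=> [x Ux|v].
  by apply: (differentiableD (df _ Ux)); exact: dg.
apply: (@eq_Ck _ (fun q => 'D_v f q + 'D_v g q)); last exact: IH (sf v) (sg v).
move=> q Uq; rewrite -[RHS]/('D_v (f + g) q) deriveD//.
- exact/diff_derivable/df.
- exact/diff_derivable/dg.
Qed.

Lemma CkM k f g : Ck k U f -> Ck k U g -> Ck k U (fun q => f q * g q).
Proof.
elim: k f g => [|k IH] f g.
  by move=> cf cg x Ux; exact: (continuousM (cf _ Ux) (cg _ Ux)).
move=> Cf Cg; have [df sf] := Cf; have [dg sg] := Cg; split=> [x Ux|v].
  by apply: (differentiableM (df _ Ux)); exact: dg.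
apply: (@eq_Ck _ (fun q => f q * 'D_v g q + g q * 'D_v f q)).
  move=> q Uq; rewrite -[RHS]/('D_v (f * g) q) deriveM//.
  - exact/diff_derivable/df.
  - exact/diff_derivable/dg.
(* The product rule involves [f] and [g] themselves, whose order is lowered by [CkW] to meet the
   induction hypothesis. *)
exact: CkD (IH _ _ (CkW Cf) (sg v)) (IH _ _ (CkW Cg) (sf v)).
Qed.

Lemma CkV k f : (forall q, U q -> f q != 0) -> Ck k U f -> Ck k U (fun q => (f q)^-1).
Proof.
move=> f0; elim: k => [|k IH].
  by move=> cf x Ux; exact: (continuousV (f0 _ Ux) (cf _ Ux)).
move=> Cf; have [df sf] := Cf; split=> [x Ux|v].
  by apply: (differentiableV (df _ Ux)); exact: f0.
(* The derivative of 1/f is -f^-2 D_v f; the inverse reappears with one order less, which the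
   induction hypothesis covers. *)
apply: (@eq_Ck _ (fun q => (-1) * ((f q)^-1 * (f q)^-1) * 'D_v f q)).
  move=> q Uq; rewrite deriveV ?f0//; last exact/diff_derivable/df.
  by rewrite -exprVn expr2 mulN1r.
have CV := IH (CkW Cf).
by apply: CkM (sf v); apply: CkM (CkM CV CV); exact: smooth_cst.
Qed.

Lemma smoothD f g : smooth_on U f -> smooth_on U g -> smooth_on U (fun q => f q + g q).
Proof. by move=> sf sg k; exact: CkD. Qed.

Lemma smoothM f g : smooth_on U f -> smooth_on U g -> smooth_on U (fun q => f q * g q).
Proof. by move=> sf sg k; exact: CkM. Qed.

Lemma smoothV f : (forall q, U q -> f q != 0) ->
  smooth_on U f -> smooth_on U (fun q => (f q)^-1).
Proof. by move=> f0 sf k; exact: CkV. Qed.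

Lemma smoothN f : smooth_on U f -> smooth_on U (fun q => - f q).
Proof.
move=> sf; apply: (@eq_smooth (fun q => -1 * f q)) => [q _|]; first by rewrite mulN1r.
by apply: smoothM => //; exact: smooth_cst.
Qed.

Lemma smoothB f g : smooth_on U f -> smooth_on U g -> smooth_on U (fun q => f q - g q).
Proof. by move=> sf sg; apply: smoothD => //; exact: smoothN. Qed.

Lemma smoothX f m : smooth_on U f -> smooth_on U (fun q => f q ^+ m).
Proof.
move=> sf; elim: m => [|m IH]; first exact: smooth_cst.
apply: (@eq_smooth (fun q => f q * f q ^+ m)); last exact: smoothM.
by move=> q _; rewrite exprS.
Qed.

Lemma smooth_sum (I : Type) (r : seq I) (F : I -> V -> R) :
  (forall i, smooth_on U (F i)) -> smooth_on U (fun q => \sum_(i <- r) F i q).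
Proof.
move=> sF; elim: r => [|i r IH].
  by under eq_fun do rewrite big_nil; exact: smooth_cst.
by under eq_fun do rewrite big_cons; exact: smoothD.
Qed.

Lemma smooth_prod (I : Type) (r : seq I) (F : I -> V -> R) :
  (forall i, smooth_on U (F i)) -> smooth_on U (fun q => \prod_(i <- r) F i q).
Proof.
move=> sF; elim: r => [|i r IH].
  by under eq_fun do rewrite big_nil; exact: smooth_cst.
by under eq_fun do rewrite big_cons; exact: smoothM.
Qed.

Lemma smooth_det m (B : V -> 'M[R]_m) :
  (forall i j, smooth_on U (fun q => B q i j)) -> smooth_on U (fun q => \det (B q)).
Proof.
move=> sB; apply: smooth_sum => s; apply: smoothM; first exact: smooth_cst.
exact: smooth_prod.
Qed.

Lemma smooth_invmx m (B : V -> 'M[R]_m) :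
  (forall i j, smooth_on U (fun q => B q i j)) ->
  (forall q, U q -> B q \in unitmx) ->
  forall i j, smooth_on U (fun q => invmx (B q) i j).
Proof.
move=> sB uB i j.
(* Entry [i j] of the inverse is the cofactor [j i] divided by the determinant. The identity is
   claimed on [U] only, since [invmx] returns a singular matrix unchanged. *)
apply: (@eq_smooth (fun q => (\det (B q))^-1 * ((-1) ^+ (j + i) *
    \det (row' j (col' i (B q)))))).
  by move=> q Uq; rewrite /invmx uB// !mxE.
apply: smoothM; first apply: smoothV; last 1 first.
- apply: smoothM; first exact: smooth_cst.
  by apply: smooth_det => a b; under eq_fun do rewrite !mxE; exact: sB.
- by move=> q Uq; move: (uB _ Uq); rewrite unitmxE unitfE.
- exact: smooth_det.
Qed.

Lemma deriveD_on f g v p : smooth_on U f -> smooth_on U g -> U p ->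
  'D_v (fun q => f q + g q) p = 'D_v f p + 'D_v g p.
Proof. by move=> sf sg Up; rewrite -deriveD //; exact: smooth_derivable. Qed.

Lemma deriveM_on f g v p : smooth_on U f -> smooth_on U g -> U p ->
  'D_v (fun q => f q * g q) p = 'D_v f p * g p + f p * 'D_v g p.
Proof.
move=> sf sg Up; rewrite -[LHS]/('D_v (f * g) p) deriveM; try exact: smooth_derivable.
by rewrite addrC mulrC.
Qed.

Lemma derive_sum_on (I : Type) (r : seq I) (F : I -> V -> R) v p :
  (forall i, smooth_on U (F i)) -> U p ->
  'D_v (fun q => \sum_(i <- r) F i q) p = \sum_(i <- r) 'D_v (F i) p.
Proof.
move=> sF Up; elim: r => [|i r IH].
  by under eq_fun do rewrite big_nil; rewrite derive_cst big_nil.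
under eq_fun do rewrite big_cons; rewrite deriveD_on ?IH ?big_cons//.
exact: smooth_sum.
Qed.

End SmoothCalculus.

(** * Local coordinates and homogeneity *)

(** A directional derivative depends only on the restriction to a line. Comparing lines in two
    spaces handles rescalings, rays and changes of coordinates. *)
Lemma eq_derive_along (R : realType) (V V' W : normedModType R)
    (f : V -> W) (g : V' -> W) p v q w :
  (forall h : R, f (h *: v + p) = g (h *: w + q)) -> 'D_v f p = 'D_w g q.
Proof.
move=> fg; have fg0 := fg 0; rewrite !scale0r !add0r in fg0.
suff E : (fun h => h^-1 *: ((f \o shift p) (h *: v) - f p)) =
    (fun h => h^-1 *: ((g \o shift q) (h *: w) - g q)) by rewrite /derive E.
by apply/funext => h /=; rewrite fg fg0.
Qed.

Section Coordinates.
Context (R : realType) (n : nat).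
Implicit Types (U : set (coordTM R n)) (f g : coordTM R n -> R) (p q : coordTM R n).

Lemma ycoord_is_linear (i : 'I_n) : linear (@ycoord R n i).
Proof. by move=> a u v; rewrite /ycoord !mxE. Qed.

HB.instance Definition _ (i : 'I_n) :=
  GRing.isLinear.Build R (coordTM R n) R *:%R (@ycoord R n i) (ycoord_is_linear i).

Lemma ycoord_continuous (i : 'I_n) : continuous (@ycoord R n i).
Proof.
move=> p; apply: (@continuous_comp _ _ _ snd (fun N : 'rV[R]_n => N 0 i)).
  exact: cvg_snd.
exact: coord_continuous.
Qed.

Lemma smooth_ycoord U (i : 'I_n) : smooth_on U (@ycoord R n i).
Proof. exact/smooth_linear/ycoord_continuous. Qed.

Lemma derive_ycoord (i : 'I_n) v p : 'D_v (@ycoord R n i) p = ycoord i v.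
Proof.
have cy : continuous (@ycoord R n i) by exact: ycoord_continuous.
by rewrite deriveE ?diff_lin //; exact: linear_differentiable.
Qed.

Lemma dx_ycoord (k i : 'I_n) p : dx k (ycoord i) p = 0.
Proof. by rewrite /dx derive_ycoord /ycoord mxE. Qed.

Lemma dy_ycoord (k i : 'I_n) p : dy k (ycoord i) p = (i == k)%:R.
Proof. by rewrite /dy derive_ycoord /ycoord mxE. Qed.

(** The differential is linear, and (x, y) is the sum of (x, 0) and the vertical basis vectors
    weighted by the coordinates of y. *)
Lemma derive_vertical f (x y : 'rV[R]_n) p : differentiable f p ->
  'D_((x, y) : coordTM R n) f p =
  'D_((x, 0) : coordTM R n) f p + \sum_(m < n) y 0 m * dy m f p.
Proof.
move=> df.
have -> : ((x, y) : coordTM R n) =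
    (x, 0) + \sum_(m < n) y 0 m *: ((0, delta_mx 0 m) : coordTM R n).
  have -> : \sum_(m < n) y 0 m *: ((0, delta_mx 0 m) : coordTM R n) = (0, y).
    rewrite [RHS](_ : _ = (0, \sum_(m < n) y 0 m *: delta_mx 0 m)); last first.
      by rewrite -row_sum_delta.
    elim/big_ind2 : _ => [//|u a v b -> ->|i _].
      by congr pair; rewrite addr0.
    by congr pair; rewrite scaler0.
  by congr pair; rewrite ?addr0 ?add0r.
rewrite !deriveE // linearD linear_sum; congr (_ + _).
by apply: eq_bigr => m _; rewrite linearZ /dy deriveE.
Qed.

(** Positive homogeneity in the fibre variable alone. The degree is a natural number, so the
    y-derivative of a function of degree 0, which has degree -1, is handled through [hom_dy_scale]
    and [hom_dy0M]. *)
Definition homogeneous U (k : nat) f :=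
  forall p (t : R), U p -> 0 < t -> f (p.1, t *: p.2) = t ^+ k * f p.

Definition cone U := forall p (t : R), U p -> 0 < t -> U (p.1, t *: p.2).

(** * Positively homogeneous functions and Euler's identity *)

Section Homogeneity.
Variable U : set (coordTM R n).
Local Notation smooth := (smooth_on U).
Local Notation hom := (homogeneous U).

Lemma hom_cst (a : R) : hom 0 (fun=> a).
Proof. by move=> p t _ _; rewrite expr0 mul1r. Qed.

Lemma hom0P f : hom 0 f <-> forall p (t : R), U p -> 0 < t -> f (p.1, t *: p.2) = f p.
Proof. by split=> hf p t Up t0; have := hf p t Up t0; rewrite expr0 mul1r. Qed.

Lemma hom_ycoord (i : 'I_n) : hom 1 (ycoord i).
Proof. by move=> p t _ _; rewrite expr1 /ycoord mxE. Qed.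

Lemma homD k f g : hom k f -> hom k g -> hom k (fun q => f q + g q).
Proof. by move=> hf hg p t Up t0; rewrite hf // hg // mulrDr. Qed.

Lemma homN k f : hom k f -> hom k (fun q => - f q).
Proof. by move=> hf p t Up t0; rewrite hf // mulrN. Qed.

Lemma homB k f g : hom k f -> hom k g -> hom k (fun q => f q - g q).
Proof. by move=> hf hg; apply: homD => //; exact: homN. Qed.

Lemma homM k l f g : hom k f -> hom l g -> hom (k + l)%N (fun q => f q * g q).
Proof.
by move=> hf hg p t Up t0; rewrite hf // hg // exprD mulrACA.
Qed.

Lemma homX f (m : nat) : hom 1 f -> hom m (fun q => f q ^+ m).
Proof. by move=> hf p t Up t0; rewrite hf // exprMn expr1. Qed.

Lemma homZ k (a : R) f : hom k f -> hom k (fun q => a * f q).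
Proof. by move=> hf p t Up t0; rewrite hf // mulrCA. Qed.

Lemma hom_sum k (I : Type) (r : seq I) (F : I -> coordTM R n -> R) :
  (forall i, hom k (F i)) -> hom k (fun q => \sum_(i <- r) F i q).
Proof. by move=> hF p t Up t0; rewrite mulr_sumr; apply: eq_bigr => i _; exact: hF. Qed.

Hypotheses (openU : open U) (coneU : cone U).

Lemma eq_hom k f g : (forall q, U q -> f q = g q) -> hom k f -> hom k g.
Proof. by move=> fg hf p t Up t0; rewrite -!fg ?hf//; exact: coneU. Qed.

(* The difference quotient of f at (x, t y) along (a, t b) is that of
   q |-> f (q.1, t q.2) at (x, y) along (a, b). *)
Lemma hom_derive k f (a b : 'rV[R]_n) p (t : R) : hom k f -> smooth f -> U p -> 0 < t ->
  'D_((a, t *: b) : coordTM R n) f (p.1, t *: p.2) =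
  t ^+ k * 'D_((a, b) : coordTM R n) f p.
Proof.
move=> hf sf Up t0.
have -> : 'D_((a, t *: b) : coordTM R n) f (p.1, t *: p.2) =
    'D_((a, b) : coordTM R n) (fun q => f (q.1, t *: q.2)) p.
  apply: eq_derive_along => h /=; congr (f _).
  by congr pair; rewrite /= scalerDr !scalerA mulrC.
rewrite (derive_eq_on openU (g := fun q => t ^+ k * f q)) //; last first.
  by move=> q Uq; exact: hf.
by rewrite (deriveM_on (U := U)) //; [rewrite derive_cst mul0r add0r|exact: smooth_cst].
Qed.

Lemma hom_dx k f (i : 'I_n) : smooth f -> hom k f -> hom k (dx i f).
Proof.
move=> sf hf p t Up t0; rewrite /dx -hom_derive //.
by rewrite scaler0.
Qed.

(** Scaling the vertical direction by [t] produces a factor [t], by linearity of the differential.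
    Keeping it on the left covers [k = 0], where the derivative has degree -1. *)
Lemma hom_dy_scale k f (i : 'I_n) p (t : R) : smooth f -> hom k f -> U p -> 0 < t ->
  t * dy i f (p.1, t *: p.2) = t ^+ k * dy i f p.
Proof.
move=> sf hf Up t0; rewrite /dy -hom_derive //.
rewrite !deriveE; try exact: (smooth_differentiable sf (coneU Up t0)).
by rewrite -linearZ; congr (_ _); congr pair; rewrite /= ?scaler0.
Qed.

Lemma hom_dy k f (i : 'I_n) : smooth f -> hom k.+1 f -> hom k (dy i f).
Proof.
move=> sf hf p t Up t0; apply: (mulfI (lt0r_neq0 t0)).
by rewrite (hom_dy_scale i sf hf) // exprS mulrA.
Qed.

(* The first factor has degree -1. *)
Lemma hom_dy0M k f g (i : 'I_n) : smooth f -> hom 0 f -> hom k.+1 g ->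
  hom k (fun q => dy i f q * g q).
Proof.
move=> sf hf hg p t Up t0.
rewrite hg // exprS -[dy i f p]mul1r -(expr0 t) -(hom_dy_scale i sf hf) //.
by ring.
Qed.

(** Along the ray through y the function is s^k f(x, y). Its derivative at s = 1 is k f(x, y), and
    it is also the derivative of f in the direction (0, y). *)
Lemma euler k f p : smooth f -> hom k f -> U p ->
  \sum_(m < n) dy m f p * ycoord m p = k%:R * f p.
Proof.
move=> sf hf Up; have df := smooth_differentiable sf Up.
have -> : \sum_(m < n) dy m f p * ycoord m p = 'D_((0, p.2) : coordTM R n) f p.
  rewrite derive_vertical // [X in X + _](_ : _ = 0) ?add0r; last first.
    by rewrite (_ : (0, 0) = 0 :> coordTM R n) // derive0.
  by apply: eq_bigr => m _; rewrite mulrC.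
have -> : 'D_((0, p.2) : coordTM R n) f p = 'D_1 (fun s : R => f (p.1, s *: p.2)) 1.
  apply: eq_derive_along => h /=; congr (f _).
  by congr pair; rewrite /= ?scaler0 ?add0r// scalerDl scale1r [h *: 1]mulr1.
(* Homogeneity applies for s > 0, which holds near s = 1. *)
rewrite (@near_eq_derive _ _ _ _ (fun s : R => s ^+ k * f p)); last first.
  near=> s; rewrite hf //; near: s; exact: lt_nbhsr.
have dX : derivable (fun s : R => s ^+ k) 1 1 by exact: exprn_derivable.
rewrite -[LHS]/('D_1 ((fun s : R => s ^+ k) * cst (f p)) 1) deriveM //.
rewrite derive_cst scaler0 add0r exp_derive expr1n.
by rewrite -[LHS]/(f p * (k%:R * 1 * 1)) !mulr1 mulrC.
Unshelve. all: by end_near. Qed.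

End Homogeneity.
End Coordinates.

(** * Pointwise algebra of a projective change *)

Section ProjectiveAlgebra.
Context (K : comPzRingType) (n : nat).

Lemma sum_deltal (f : 'I_n -> K) i : \sum_(m < n) f m * (i == m)%:R = f i.
Proof.
rewrite (bigD1 i) //= eqxx mulr1 big1 ?addr0 // => m.
by rewrite eq_sym => /negPf ->; rewrite mulr0.
Qed.

Lemma sum_deltar (f : 'I_n -> K) i : \sum_(m < n) f m * (m == i)%:R = f i.
Proof. by under eq_bigr do rewrite eq_sym; exact: sum_deltal. Qed.

(* The value at a point of R^i_k, for a spray with values g^i and partial
   derivatives gx^i_k, gy^i_k, gxy^i_mk (first in y^k, then in x^m), gyy^i_mk. *)
Definition riemann_value (y g : 'I_n -> K) (gx gy : 'I_n -> 'I_n -> K)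
    (gxy gyy : 'I_n -> 'I_n -> 'I_n -> K) (i k : 'I_n) : K :=
  2 * gx i k - \sum_(m < n) gxy i m k * y m + 2 * (\sum_(m < n) g m * gyy i m k)
  - \sum_(m < n) gy i m * gy m k.

Lemma eq_riemann_value y (g g' : 'I_n -> K) (gx gx' gy gy' : 'I_n -> 'I_n -> K)
    (gxy gxy' gyy gyy' : 'I_n -> 'I_n -> 'I_n -> K) i k :
  g =1 g' -> gx =2 gx' -> gy =2 gy' -> (forall i, gxy i =2 gxy' i) ->
  (forall i, gyy i =2 gyy' i) ->
  riemann_value y g gx gy gxy gyy i k = riemann_value y g' gx' gy' gxy' gyy' i k.
Proof.
move=> eg egx egy egxy egyy; rewrite /riemann_value egx; congr (_ - _ + 2 * _ - _).
- by apply: eq_bigr => m _; rewrite egxy.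
- by apply: eq_bigr => m _; rewrite eg egyy.
- by apply: eq_bigr => m _; rewrite !egy.
Qed.

(** With [b] for Gb and [u] for P, the left side lists the derivatives of Gb^i + P y^i given by the
    product rule. The coefficients of the Kronecker symbol and of y^i on the right are Xi and
    tau_k. *)
Lemma riemann_value_projective (y b ux uy : 'I_n -> K) (u : K)
    (uxy uyy bx by_ : 'I_n -> 'I_n -> K) (bxy byy : 'I_n -> 'I_n -> 'I_n -> K) i k :
  \sum_(m < n) by_ i m * y m = 2 * b i ->
  \sum_(m < n) byy i m k * y m = by_ i k ->
  \sum_(m < n) uy m * y m = u ->
  \sum_(m < n) uyy m k * y m = 0 ->
  riemann_value y (fun i => b i + u * y i)
    (fun i k => bx i k + ux k * y i)
    (fun i k => by_ i k + (uy k * y i + u * (i == k)%:R))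
    (fun i m k => bxy i m k + (uxy m k * y i + ux m * (i == k)%:R))
    (fun i m k => byy i m k +
       (uyy m k * y i + uy k * (i == m)%:R + uy m * (i == k)%:R)) i k =
  riemann_value y b bx by_ bxy byy i k
  + (u ^+ 2 - \sum_(m < n) ux m * y m + 2 * (\sum_(m < n) b m * uy m)) * (i == k)%:R
  + (2 * ux k - \sum_(m < n) uxy m k * y m + 2 * (\sum_(m < n) b m * uyy m k)
     - \sum_(m < n) uy m * by_ m k - u * uy k) * y i.
Proof.
move=> euler_b euler_by euler_u euler_uy; rewrite /riemann_value.
have -> : \sum_(m < n) (bxy i m k + (uxy m k * y i + ux m * (i == k)%:R)) * y m =
    \sum_(m < n) bxy i m k * y m + (\sum_(m < n) uxy m k * y m) * y i
    + (\sum_(m < n) ux m * y m) * (i == k)%:R.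
  by rewrite !mulr_suml -!big_split /=; apply: eq_bigr => m _; ring.
have -> : \sum_(m < n) (b m + u * y m) * (byy i m k +
       (uyy m k * y i + uy k * (i == m)%:R + uy m * (i == k)%:R)) =
    \sum_(m < n) b m * byy i m k + (\sum_(m < n) b m * uyy m k) * y i
    + b i * uy k + (\sum_(m < n) b m * uy m) * (i == k)%:R
    + by_ i k * u + y i * (u * uy k) + u * (u * (i == k)%:R).
  (* Each contraction with y or with a Kronecker symbol is isolated, so that Euler's identities and
     the delta sums can evaluate it. *)
  transitivity (\sum_(m < n) b m * byy i m k + (\sum_(m < n) b m * uyy m k) * y i
    + (\sum_(m < n) b m * (i == m)%:R) * uy k
    + (\sum_(m < n) b m * uy m) * (i == k)%:R
    + (\sum_(m < n) byy i m k * y m) * u + (\sum_(m < n) uyy m k * y m) * (u * y i)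
    + (\sum_(m < n) y m * (i == m)%:R) * (u * uy k)
    + (\sum_(m < n) uy m * y m) * (u * (i == k)%:R)).
    by rewrite !mulr_suml -!big_split /=; apply: eq_bigr => m _; ring.
  by rewrite !sum_deltal euler_by euler_u euler_uy; ring.
have -> : \sum_(m < n) (by_ i m + (uy m * y i + u * (i == m)%:R)) *
       (by_ m k + (uy k * y m + u * (m == k)%:R)) =
    \sum_(m < n) by_ i m * by_ m k + 2 * b i * uy k + 2 * by_ i k * u
    + (\sum_(m < n) uy m * by_ m k) * y i + 3 * u * uy k * y i
    + u ^+ 2 * (i == k)%:R.
  transitivity (\sum_(m < n) by_ i m * by_ m k
    + (\sum_(m < n) by_ i m * y m) * uy k + (\sum_(m < n) by_ i m * (m == k)%:R) * u
    + (\sum_(m < n) uy m * by_ m k) * y i + (\sum_(m < n) uy m * y m) * (uy k * y i)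
    + (\sum_(m < n) uy m * (m == k)%:R) * (u * y i)
    + (\sum_(m < n) by_ m k * (i == m)%:R) * u
    + (\sum_(m < n) y m * (i == m)%:R) * (u * uy k)
    + (\sum_(m < n) (m == k)%:R * (i == m)%:R) * (u * u)).
    by rewrite !mulr_suml -!big_split /=; apply: eq_bigr => m _; ring.
  by rewrite !sum_deltal !sum_deltar euler_b euler_u; ring.
by ring.
Qed.

(** Write D for the x-derivative of P contracted with y. By Euler's identities the five terms
    contract to 2 D, -D, 0, -2 b^m P_.m and -P^2, which add up to -Xi. *)
Lemma sum_tau (y b ux uy : 'I_n -> K) (u : K) (uxy uyy by_ : 'I_n -> 'I_n -> K) :
  (forall m, \sum_(k < n) by_ m k * y k = 2 * b m) ->
  \sum_(k < n) uy k * y k = u ->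
  (forall m, \sum_(k < n) uxy m k * y k = ux m) ->
  (forall m, \sum_(k < n) uyy m k * y k = 0) ->
  \sum_(k < n) (2 * ux k - \sum_(m < n) uxy m k * y m
     + 2 * (\sum_(m < n) b m * uyy m k) - \sum_(m < n) uy m * by_ m k - u * uy k) * y k =
  - (u ^+ 2 - \sum_(m < n) ux m * y m + 2 * (\sum_(m < n) b m * uy m)).
Proof.
move=> euler_b euler_u euler_ux euler_uy.
have sumxy : \sum_(k < n) (\sum_(m < n) uxy m k * y m) * y k = \sum_(m < n) ux m * y m.
  under eq_bigr do rewrite mulr_suml; rewrite exchange_big /=; apply: eq_bigr => m _.
  by rewrite -euler_ux mulr_suml; apply: eq_bigr => k _; ring.
have sumyy : \sum_(k < n) (\sum_(m < n) b m * uyy m k) * y k = 0.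
  under eq_bigr do rewrite mulr_suml; rewrite exchange_big /= big1 // => m _.
  by under eq_bigr do rewrite -mulrA; rewrite -mulr_sumr euler_uy mulr0.
have sumby : \sum_(k < n) (\sum_(m < n) uy m * by_ m k) * y k =
    2 * (\sum_(m < n) b m * uy m).
  under eq_bigr do rewrite mulr_suml; rewrite exchange_big mulr_sumr /=.
  apply: eq_bigr => m _; under eq_bigr do rewrite -mulrA.
  by rewrite -mulr_sumr euler_b; ring.
transitivity (2 * (\sum_(k < n) ux k * y k)
    - \sum_(k < n) (\sum_(m < n) uxy m k * y m) * y k
    + 2 * (\sum_(k < n) (\sum_(m < n) b m * uyy m k) * y k)
    - \sum_(k < n) (\sum_(m < n) uy m * by_ m k) * y k
    - u * (\sum_(k < n) uy k * y k)).
  rewrite !mulr_sumr -!sumrN -!big_split /=.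
  by apply: eq_bigr => k _; ring.
by rewrite sumxy sumyy sumby euler_u; ring.
Qed.

(* The value at a point of T_j^i_kl|0, where Nv^r_m and Gam^i_rm are the values
   of the Berwald connection coefficients and tx_m, ty_r those of the partial
   derivatives of T_j^i_kl. *)
Definition hcov0_value (y : 'I_n -> K) (Nv : 'I_n -> 'I_n -> K)
    (Gam : 'I_n -> 'I_n -> 'I_n -> K) (tx ty : 'I_n -> K)
    (T : 'I_n -> 'I_n -> 'I_n -> 'I_n -> K) (j i k l : 'I_n) : K :=
  \sum_(m < n) (tx m - \sum_(r < n) Nv r m * ty r
    + \sum_(r < n) Gam i r m * T j r k l - \sum_(r < n) Gam r j m * T r i k l
    - \sum_(r < n) Gam r k m * T j i r l - \sum_(r < n) Gam r l m * T j i k r) * y m.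

Lemma eq_hcov0_value y (Nv Nv' : 'I_n -> 'I_n -> K)
    (Gam Gam' : 'I_n -> 'I_n -> 'I_n -> K) (tx tx' ty ty' : 'I_n -> K)
    (T T' : 'I_n -> 'I_n -> 'I_n -> 'I_n -> K) j i k l :
  Nv =2 Nv' -> (forall i, Gam i =2 Gam' i) -> tx =1 tx' -> ty =1 ty' ->
  (forall j i, T j i =2 T' j i) ->
  hcov0_value y Nv Gam tx ty T j i k l = hcov0_value y Nv' Gam' tx' ty' T' j i k l.
Proof.
move=> eN eG ex ey eT; apply: eq_bigr => m _; congr (_ * _); rewrite ex.
congr (_ - _ + _ - _ - _ - _); apply: eq_bigr => r _;
  by rewrite ?eN ?eG ?ey ?eT.
Qed.

(** Summing over m first exposes the contractions of the connection coefficients with y, whose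
    change under a projective change is simple. *)
Lemma hcov0_valueE y Nv Gam tx ty T j i k l :
  hcov0_value y Nv Gam tx ty T j i k l =
  \sum_(m < n) tx m * y m - \sum_(r < n) (\sum_(m < n) Nv r m * y m) * ty r
  + \sum_(r < n) (\sum_(m < n) Gam i r m * y m) * T j r k l
  - \sum_(r < n) (\sum_(m < n) Gam r j m * y m) * T r i k l
  - \sum_(r < n) (\sum_(m < n) Gam r k m * y m) * T j i r l
  - \sum_(r < n) (\sum_(m < n) Gam r l m * y m) * T j i k r.
Proof.
have exch (a : 'I_n -> 'I_n -> K) (t : 'I_n -> K) :
    \sum_(r < n) (\sum_(m < n) a r m * y m) * t r =
    \sum_(m < n) (\sum_(r < n) a r m * t r) * y m.
  under eq_bigr do rewrite mulr_suml; rewrite exchange_big /=; apply: eq_bigr => m _.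
  by rewrite mulr_suml; apply: eq_bigr => r _; ring.
rewrite (exch Nv ty) (exch (Gam i) (fun r => T j r k l)).
rewrite (exch (Gam ^~ j) (fun r => T r i k l)) (exch (Gam ^~ k) (fun r => T j i r l)).
rewrite (exch (Gam ^~ l) (fun r => T j i k r)).
by rewrite -!sumrN -!big_split /=; apply: eq_bigr => m _; ring.
Qed.

Lemma sum_shift (a t y : 'I_n -> K) c u i :
  \sum_(r < n) (a r + (c * y r + u * (r == i)%:R)) * t r =
  \sum_(r < n) a r * t r + c * (\sum_(r < n) t r * y r) + u * t i.
Proof.
rewrite -[t i](sum_deltar t) !mulr_sumr -!big_split /=.
by apply: eq_bigr => r _; ring.
Qed.

(** After contraction with y, N^r changes by 2 P y^r, which is killed because T has degree 0, and
    Gam^a_r changes by P_.r y^a + P delta^a_r. The upper index thus contributes P T plus the term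
    along y^i, and each of the three lower indices contributes -P T, since T contracted with y
    vanishes there. The total multiple of T is -2 P. *)
Lemma hcov0_value_projective (y : 'I_n -> K) Nv Gam tx ty T (u : K) uy uyy j i k l :
  \sum_(m < n) uy m * y m = u ->
  (forall r, \sum_(m < n) uyy m r * y m = 0) ->
  \sum_(r < n) ty r * y r = 0 ->
  \sum_(r < n) T r i k l * y r = 0 ->
  \sum_(r < n) T j i r l * y r = 0 ->
  \sum_(r < n) T j i k r * y r = 0 ->
  hcov0_value y (fun r m => Nv r m + (uy m * y r + u * (r == m)%:R))
    (fun i r m => Gam i r m +
       (uyy m r * y i + uy r * (i == m)%:R + uy m * (i == r)%:R)) tx ty T j i k l =
  hcov0_value y Nv Gam tx ty T j i k l - 2 * u * T j i k l
  + (\sum_(r < n) uy r * T j r k l) * y i.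
Proof.
move=> euler_u euler_uy euler_t Tj Tk Tl; rewrite !hcov0_valueE.
have N0 r : \sum_(m < n) (Nv r m + (uy m * y r + u * (r == m)%:R)) * y m =
    \sum_(m < n) Nv r m * y m + 2 * u * y r.
  transitivity (\sum_(m < n) Nv r m * y m + (\sum_(m < n) uy m * y m) * y r
    + (\sum_(m < n) y m * (r == m)%:R) * u).
    by rewrite !mulr_suml -!big_split /=; apply: eq_bigr => m _; ring.
  by rewrite euler_u sum_deltal; ring.
have G0 a r : \sum_(m < n) (Gam a r m +
       (uyy m r * y a + uy r * (a == m)%:R + uy m * (a == r)%:R)) * y m =
    \sum_(m < n) Gam a r m * y m + (uy r * y a + u * (a == r)%:R).
  transitivity (\sum_(m < n) Gam a r m * y m + (\sum_(m < n) uyy m r * y m) * y a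
    + (\sum_(m < n) y m * (a == m)%:R) * uy r
    + (\sum_(m < n) uy m * y m) * (a == r)%:R).
    by rewrite !mulr_suml -!big_split /=; apply: eq_bigr => m _; ring.
  by rewrite euler_u euler_uy sum_deltal; ring.
have lower (t : 'I_n -> K) a : \sum_(r < n) t r * y r = 0 ->
    \sum_(r < n) (\sum_(m < n) (Gam r a m +
       (uyy m a * y r + uy a * (r == m)%:R + uy m * (r == a)%:R)) * y m) * t r =
    \sum_(r < n) (\sum_(m < n) Gam r a m * y m) * t r + u * t a.
  move=> ty0; under eq_bigr do rewrite G0.
  by rewrite (sum_shift (fun r => \sum_(m < n) Gam r a m * y m)) ty0; ring.
rewrite (lower (fun r => T r i k l)) // (lower (fun r => T j i r l)) //.
rewrite (lower (fun r => T j i k r)) //.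
have -> : \sum_(r < n) (\sum_(m < n) (Nv r m + (uy m * y r + u * (r == m)%:R)) * y m)
      * ty r = \sum_(r < n) (\sum_(m < n) Nv r m * y m) * ty r.
  under eq_bigr do rewrite N0.
  transitivity (\sum_(r < n) ((\sum_(m < n) Nv r m * y m) * ty r
    + ty r * y r * (2 * u))); first by apply: eq_bigr => r _; ring.
  by rewrite big_split /= -mulr_suml euler_t mul0r addr0.
have -> : \sum_(r < n) (\sum_(m < n) (Gam i r m +
       (uyy m r * y i + uy r * (i == m)%:R + uy m * (i == r)%:R)) * y m) * T j r k l =
    \sum_(r < n) (\sum_(m < n) Gam i r m * y m) * T j r k l
    + (\sum_(r < n) uy r * T j r k l) * y i + u * T j i k l.
  under eq_bigr do rewrite G0.
  transitivity (\sum_(r < n) ((\sum_(m < n) Gam i r m * y m) * T j r k l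
    + uy r * T j r k l * y i + T j r k l * (i == r)%:R * u)).
    by apply: eq_bigr => r _; ring.
  rewrite !big_split /= -!mulr_suml (sum_deltal (fun r => T j r k l)); ring.
by ring.
Qed.

End ProjectiveAlgebra.

(** * Sprays and curvatures *)

Section Sprays.
Context (R : realType) (n : nat) (U : set (coordTM R n)).
Implicit Types (f g : coordTM R n -> R) (p : coordTM R n).
Hypotheses (openU : open U) (coneU : cone U).
Local Notation smooth := (smooth_on U).
Local Notation hom := (homogeneous U).

Lemma smooth_dx f (k : 'I_n) : smooth f -> smooth (dx k f).
Proof. exact: smooth_derive. Qed.

Lemma smooth_dy f (k : 'I_n) : smooth f -> smooth (dy k f).
Proof. exact: smooth_derive. Qed.

Ltac smooth_tac := repeat lazymatch goal with
  | |- smooth_on ?U (fun q => ?h q) => change (smooth_on U h)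
  | |- smooth_on _ (dx _ _) => apply: smooth_dx
  | |- smooth_on _ (dy _ _) => apply: smooth_dy
  | |- smooth_on _ (ycoord _) => exact: smooth_ycoord
  | |- smooth_on _ (fun _ => ?a) => exact: smooth_cst
  | |- smooth_on _ (fun q => @?f q + - @?g q) => apply: (smoothB openU (f := f) (g := g))
  | |- smooth_on _ (fun q => @?f q + @?g q) => apply: (smoothD openU (f := f) (g := g))
  | |- smooth_on _ (fun q => - @?f q) => apply: (smoothN openU (f := f))
  | |- smooth_on _ (fun q => @?f q * @?g q) => apply: (smoothM openU (f := f) (g := g))
  | |- smooth_on _ (fun q => @?f q ^+ _) => apply: (smoothX openU (f := f))
  | |- smooth_on _ (fun q => bigop.body _ _ (@?F q)) => apply: (smooth_sum openU) => ?
  | |- smooth_on _ _ => auto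
  end.

Lemma dx_eq_on f g k p : (forall q, U q -> f q = g q) -> U p -> dx k f p = dx k g p.
Proof. exact: derive_eq_on. Qed.

Lemma dxD f g (k : 'I_n) p : smooth f -> smooth g -> U p ->
  dx k (fun q => f q + g q) p = dx k f p + dx k g p.
Proof. exact: deriveD_on. Qed.

Lemma dxM f g (k : 'I_n) p : smooth f -> smooth g -> U p ->
  dx k (fun q => f q * g q) p = dx k f p * g p + f p * dx k g p.
Proof. exact: deriveM_on. Qed.

Lemma dx_sum (F : 'I_n -> coordTM R n -> R) (k : 'I_n) p :
  (forall i, smooth (F i)) -> U p ->
  dx k (fun q => \sum_(i < n) F i q) p = \sum_(i < n) dx k (F i) p.
Proof. exact: derive_sum_on. Qed.

Lemma dx_cst (a : R) (k : 'I_n) p : dx k (fun=> a) p = 0.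
Proof. exact: derive_cst. Qed.

Lemma dy_eq_on f g k p : (forall q, U q -> f q = g q) -> U p -> dy k f p = dy k g p.
Proof. exact: derive_eq_on. Qed.

Lemma dyD f g (k : 'I_n) p : smooth f -> smooth g -> U p ->
  dy k (fun q => f q + g q) p = dy k f p + dy k g p.
Proof. exact: deriveD_on. Qed.

Lemma dyM f g (k : 'I_n) p : smooth f -> smooth g -> U p ->
  dy k (fun q => f q * g q) p = dy k f p * g p + f p * dy k g p.
Proof. exact: deriveM_on. Qed.

Lemma dy_sum (F : 'I_n -> coordTM R n -> R) (k : 'I_n) p :
  (forall i, smooth (F i)) -> U p ->
  dy k (fun q => \sum_(i < n) F i q) p = \sum_(i < n) dy k (F i) p.
Proof. exact: derive_sum_on. Qed.

Lemma dy_cst (a : R) (k : 'I_n) p : dy k (fun=> a) p = 0.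
Proof. exact: derive_cst. Qed.

Lemma dxMy f (k i : 'I_n) p : smooth f -> U p ->
  dx k (fun q => f q * ycoord i q) p = dx k f p * ycoord i p.
Proof.
move=> sf Up; rewrite dxM //; last exact: smooth_ycoord.
by rewrite dx_ycoord mulr0 addr0.
Qed.

Lemma dyMy f (k i : 'I_n) p : smooth f -> U p ->
  dy k (fun q => f q * ycoord i q) p = dy k f p * ycoord i p + f p * (i == k)%:R.
Proof.
move=> sf Up; rewrite dyM //; last exact: smooth_ycoord.
by rewrite dy_ycoord.
Qed.

Lemma dxMc f (a : R) (k : 'I_n) p : smooth f -> U p ->
  dx k (fun q => f q * a) p = dx k f p * a.
Proof.
move=> sf Up; rewrite dxM //; last exact: smooth_cst.
by rewrite dx_cst mulr0 addr0.
Qed.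

Lemma dyMc f (a : R) (k : 'I_n) p : smooth f -> U p ->
  dy k (fun q => f q * a) p = dy k f p * a.
Proof.
move=> sf Up; rewrite dyM //; last exact: smooth_cst.
by rewrite dy_cst mulr0 addr0.
Qed.

Lemma dyN f (k : 'I_n) p : smooth f -> U p -> dy k (fun q => - f q) p = - dy k f p.
Proof. by move=> sf Up; rewrite /dy -deriveN //; exact: smooth_derivable Up. Qed.

(** Euler's identity in degree 1 is differentiated in x^k, the contraction bearing on the inner
    derivative. *)
Lemma sum_dxdy f (k : 'I_n) p : smooth f -> hom 1 f -> U p ->
  \sum_(m < n) dx k (dy m f) p * ycoord m p = dx k f p.
Proof.
move=> sf hf Up; have sdf m : smooth (dy m f) by smooth_tac.
rewrite [RHS](dx_eq_on (g := fun q => \sum_(m < n) dy m f q * ycoord m q)) //.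
  rewrite dx_sum //; last by move=> m; smooth_tac.
  by apply: eq_bigr => m _; rewrite dxMy.
by move=> q Uq; rewrite (euler sf hf Uq) mul1r.
Qed.

(** Differentiating Euler's identity in y^k, the factor y^m contributes [dy k f], which cancels the
    other side. *)
Lemma sum_dydy f (k : 'I_n) p : smooth f -> hom 1 f -> U p ->
  \sum_(m < n) dy k (dy m f) p * ycoord m p = 0.
Proof.
move=> sf hf Up; have sdf m : smooth (dy m f) by smooth_tac.
apply: (@addIr _ (dy k f p)); rewrite add0r.
rewrite [RHS](dy_eq_on (g := fun q => \sum_(m < n) dy m f q * ycoord m q)) //.
  rewrite dy_sum //; last by move=> m; smooth_tac.
  rewrite -[X in _ + X](sum_deltar (fun m => dy m f p)) -big_split /=.
  by apply: eq_bigr => m _; rewrite dyMy.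
by move=> q Uq; rewrite (euler sf hf Uq) mul1r.
Qed.

(** The curvature as a function of the spray alone, so that the change formula can be stated for any
    two families of spray coefficients. *)
Definition riemann_of_spray (G : 'I_n -> coordTM R n -> R) (i k : 'I_n) p : R :=
  riemann_value (fun i => ycoord i p) (fun i => G i p) (fun i k => dx k (G i) p)
    (fun i k => dy k (G i) p) (fun i m k => dx m (dy k (G i)) p)
    (fun i m k => dy m (dy k (G i)) p) i k.

Lemma riemannE F : riemann F = riemann_of_spray (spray F).
Proof. by []. Qed.

(** * Smoothness and homogeneity of the spray of a metric *)

Section SprayRegularity.
Variable F : coordTM R n -> R.
Hypotheses (sF : smooth F) (hF : hom 1 F).

Lemma smooth_spray : (forall p, U p -> fundamental F p \in unitmx) ->
  forall i, smooth (spray F i).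
Proof.
move=> gU i; apply: (smoothM openU); first exact: smooth_cst.
apply: (smooth_sum openU) => l; apply: (smoothM openU); last by smooth_tac.
apply: (smooth_invmx openU _ gU) => a b.
apply: (eq_smooth openU (f := fun q => 2^-1 * dy b (dy a (fun q => F q ^+ 2)) q)).
  by move=> q _; rewrite mxE.
by smooth_tac.
Qed.

Lemma hom_F2 : hom 2 (fun q => F q ^+ 2).
Proof. exact: homX. Qed.

Lemma hom_dyF2 i : hom 1 (dy i (fun q => F q ^+ 2)).
Proof. by apply: (hom_dy openU coneU (k := 1)); [smooth_tac|exact: hom_F2]. Qed.

Lemma hom_spray i : hom 2 (spray F i).
Proof.
have sF2 : smooth (fun q => F q ^+ 2) by smooth_tac.
apply: homZ; apply: hom_sum => l.
apply: (homM (k := 0) (l := 2)).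
  (* The g_ij have degree 0, so the matrix, and with it its inverse, is constant along rays. *)
  apply/hom0P => p t Up t0.
  suff -> : fundamental F (p.1, t *: p.2) = fundamental F p by [].
  apply/matrixP => a b; rewrite [LHS]mxE [RHS]mxE.
  have sdF : smooth (dy a (fun q => F q ^+ 2)) by smooth_tac.
  have /hom0P h0 := hom_dy openU coneU b sdF (hom_dyF2 a).
  by rewrite h0.
apply: homB; last exact: (hom_dx openU l sF2 hom_F2).
apply: hom_sum => k; apply: (homM (k := 1) (l := 1)); last exact: hom_ycoord.
apply: (hom_dy openU coneU (k := 1)); first by smooth_tac.
exact: (hom_dx openU k sF2 hom_F2).
Qed.

(** Euler's identity is used twice: in degree 1 for the y-derivatives of F^2, then in degree 2 for
    F^2 itself. *)
Lemma fundamental_diag p : U p ->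
  (p.2 *m fundamental F p *m p.2^T) 0 0 = F p ^+ 2.
Proof.
move=> Up; have sF2 : smooth (fun q => F q ^+ 2) by smooth_tac.
rewrite -mulmxA mxE.
transitivity (\sum_(i < n) 2^-1 * (dy i (fun q => F q ^+ 2) p * ycoord i p)).
  apply: eq_bigr => i _; rewrite mxE.
  have sdF : smooth (dy i (fun q => F q ^+ 2)) by smooth_tac.
  rewrite -[dy i _ p]mul1r -(euler (k := 1) sdF (hom_dyF2 i) Up).
  rewrite /ycoord mulrC mulrA mulr_sumr; congr (_ * _).
  by apply: eq_bigr => j _; rewrite !mxE mulrA.
by rewrite -mulr_sumr (euler (k := 2) sF2 hom_F2 Up) mulrA mulVf ?mul1r.
Qed.

End SprayRegularity.

(** * Change of the Riemann curvature under a projective change of spray *)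

Section ProjectiveChange.
Variables (G B : 'I_n -> coordTM R n -> R) (P : coordTM R n -> R).
Hypotheses (sB : forall i, smooth (B i)) (hB : forall i, hom 2 (B i)).
Hypotheses (sP : smooth P) (hP : hom 1 P).
Hypothesis GE : forall i p, U p -> G i p = B i p + P p * ycoord i p.

Lemma dx_spray i k p : U p ->
  dx k (G i) p = dx k (B i) p + dx k P p * ycoord i p.
Proof.
move=> Up; rewrite (dx_eq_on _ (@GE i)) // dxD //; last by smooth_tac.
by rewrite dxMy.
Qed.

Lemma dy_spray i k p : U p ->
  dy k (G i) p = dy k (B i) p + (dy k P p * ycoord i p + P p * (i == k)%:R).
Proof.
move=> Up; rewrite (dy_eq_on _ (@GE i)) // dyD //; last by smooth_tac.
by rewrite dyMy.
Qed.

Lemma dxdy_spray i k m p : U p ->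
  dx m (dy k (G i)) p = dx m (dy k (B i)) p +
    (dx m (dy k P) p * ycoord i p + dx m P p * (i == k)%:R).
Proof.
move=> Up; rewrite (dx_eq_on _ (@dy_spray i k)) //.
do 2 (rewrite dxD //; try by smooth_tac).
by rewrite dxMy ?dxMc //; smooth_tac.
Qed.

Lemma dydy_spray i k m p : U p ->
  dy m (dy k (G i)) p = dy m (dy k (B i)) p +
    (dy m (dy k P) p * ycoord i p + dy k P p * (i == m)%:R + dy m P p * (i == k)%:R).
Proof.
move=> Up; rewrite (dy_eq_on _ (@dy_spray i k)) //.
do 2 (rewrite dyD //; try by smooth_tac).
by rewrite dyMy ?dyMc //; smooth_tac.
Qed.

(** This is Xi. Since N^r_m y^m = 2 B^r, it equals P^2 - P_||0 for the Berwald connection of [B]. *)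
Definition curvature_shift p := P p ^+ 2 - \sum_(m < n) dx m P p * ycoord m p
  + 2 * \sum_(m < n) B m p * dy m P p.

(** This is tau_k, which in terms of the Berwald connection of [B] reads 2 P_||k - P_.k||0 - P
    P_.k. *)
Definition curvature_tau k p := 2 * dx k P p
  - \sum_(m < n) dx m (dy k P) p * ycoord m p
  + 2 * \sum_(m < n) B m p * dy m (dy k P) p
  - \sum_(m < n) dy m P p * dy k (B m) p - P p * dy k P p.

Lemma euler_B i p : U p ->
  \sum_(m < n) dy m (B i) p * ycoord m p = 2 * B i p.
Proof. by move=> Up; rewrite (euler (U := U) (k := 2)). Qed.

Lemma hom_dyB i k : hom 1 (dy k (B i)).
Proof. exact: (hom_dy openU coneU (k := 1)). Qed.

Lemma euler_dyB i k p : U p ->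
  \sum_(m < n) dy m (dy k (B i)) p * ycoord m p = dy k (B i) p.
Proof.
move=> Up; have sdB : smooth (dy k (B i)) by smooth_tac.
by rewrite (euler (k := 1) sdB (@hom_dyB i k)) // mul1r.
Qed.

Lemma euler_P p : U p -> \sum_(m < n) dy m P p * ycoord m p = P p.
Proof. by move=> Up; rewrite (euler (U := U) (k := 1)) // mul1r. Qed.

Lemma hom_dyP k : hom 0 (dy k P).
Proof. exact: (hom_dy openU coneU (k := 0)). Qed.

Lemma euler_dyP k p : U p -> \sum_(m < n) dy m (dy k P) p * ycoord m p = 0.
Proof.
move=> Up; have sdP : smooth (dy k P) by smooth_tac.
by rewrite (euler (k := 0) sdP (@hom_dyP k)) // mul0r.
Qed.

Lemma riemann_projective i k p : U p ->
  riemann_of_spray G i k p = riemann_of_spray B i k p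
    + curvature_shift p * (i == k)%:R
    + curvature_tau k p * ycoord i p.
Proof.
move=> Up; apply: etrans (@riemann_value_projective R n (fun i => ycoord i p)
  (fun i => B i p) (fun m => dx m P p) (fun m => dy m P p) (P p)
  (fun m k => dx m (dy k P) p) (fun m k => dy m (dy k P) p)
  (fun i k => dx k (B i) p) (fun i k => dy k (B i) p)
  (fun i m k => dx m (dy k (B i)) p) (fun i m k => dy m (dy k (B i)) p) i k
  (euler_B i Up) (euler_dyB i k Up) (euler_P Up) (euler_dyP k Up)).
apply: eq_riemann_value => [j|j l|j l|j m l|j m l].
- exact: GE.
- exact: dx_spray.
- exact: dy_spray.
- exact: dxdy_spray.
- exact: dydy_spray.
Qed.

Lemma smooth_tau k : smooth (curvature_tau k).
Proof. by rewrite /curvature_tau; smooth_tac. Qed.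

Lemma hom_tau k : hom 1 (curvature_tau k).
Proof.
have hdP m : hom 0 (dy m P) := @hom_dyP m.
have hdxP m : hom 1 (dx m P) := hom_dx openU m sP hP.
have sdP m : smooth (dy m P) by smooth_tac.
apply: homB; last by apply: (homM (k := 1) (l := 0)).
apply: homB; last first.
  apply: hom_sum => m; exact: (homM (k := 0) (l := 1) (hdP m) (@hom_dyB m k)).
apply: homD; last first.
  apply: homZ; apply: hom_sum => m.
  (* The second y-derivative of P has degree -1 and B^m has degree 2; the factors are swapped to fit
     [hom_dy0M]. *)
  apply: (eq_hom coneU (f := fun q => dy m (dy k P) q * B m q)) => [q _|].
    by rewrite mulrC.
  exact: (hom_dy0M openU coneU m (sdP k) (hdP k) (hB m)).
apply: homB; first exact: homZ.
apply: hom_sum => m; apply: (homM (k := 0) (l := 1)); last exact: hom_ycoord.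
exact: hom_dx.
Qed.

Lemma tau_y p : U p -> \sum_(m < n) curvature_tau m p * ycoord m p = - curvature_shift p.
Proof.
move=> Up; exact: (@sum_tau R n (fun i => ycoord i p) (fun i => B i p)
  (fun m => dx m P p) (fun m => dy m P p) (P p)
  (fun m k => dx m (dy k P) p) (fun m k => dy m (dy k P) p) (fun i k => dy k (B i) p)
  (fun m => euler_B m Up) (euler_P Up) (fun m => sum_dxdy m sP hP Up)
  (fun m => sum_dydy m sP hP Up)).
Qed.

End ProjectiveChange.

(** * Homogeneity of the Weyl curvatures and contractions of the weakly-Weyl curvature *)

Section Curvature.
Variable F : coordTM R n -> R.
Hypotheses (sG : forall i, smooth (spray F i)) (hG : forall i, hom 2 (spray F i)).

Lemma smooth_riemann i k : smooth (riemann F i k).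
Proof. by rewrite /riemann; smooth_tac. Qed.

Lemma smooth_scalarR : smooth (scalarR F).
Proof.
have sR m := @smooth_riemann m m.
by rewrite /scalarR; smooth_tac.
Qed.

Lemma smooth_tensorA i k : smooth (tensorA F i k).
Proof.
have [sR sS] := (smooth_riemann, smooth_scalarR).
by rewrite /tensorA; smooth_tac.
Qed.

Lemma smooth_weyl i k : smooth (weyl F i k).
Proof. by have sA := smooth_tensorA; rewrite /weyl; smooth_tac. Qed.

Lemma hom_riemann i k : hom 2 (riemann F i k).
Proof.
have hdG a b : hom 1 (dy b (spray F a)) by exact: (hom_dy openU coneU (k := 1)).
have sdG a b : smooth (dy b (spray F a)) by smooth_tac.
apply: homB; last first.
  by apply: hom_sum => m; exact: (homM (k := 1) (l := 1) (hdG i m) (hdG m k)).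
apply: homD; last first.
  apply: homZ; apply: hom_sum => m; apply: (homM (k := 2) (l := 0)) => //.
  exact: (hom_dy openU coneU m (sdG i k) (hdG i k)).
apply: homB; first by apply: homZ; exact: (hom_dx openU k (sG i) (hG i)).
apply: hom_sum => m; apply: (homM (k := 1) (l := 1)); last exact: (@hom_ycoord _ _ _ m).
exact: (hom_dx openU m (sdG i k) (hdG i k)).
Qed.

Lemma hom_tensorA i k : hom 2 (tensorA F i k).
Proof.
apply: homB; first exact: hom_riemann.
apply: (homM (k := 2) (l := 0)); last exact: hom_cst.
by apply: homZ; apply: hom_sum => m; exact: hom_riemann.
Qed.

Lemma hom_weyl i k : hom 2 (weyl F i k).
Proof.
apply: homB; first exact: hom_tensorA.
apply: (homM (k := 1) (l := 1)); last exact: (@hom_ycoord _ _ _ i).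
apply: homZ; apply: hom_sum => m.
exact: (hom_dy openU coneU m (@smooth_tensorA m k) (@hom_tensorA m k)).
Qed.

(** The tensor of degree 1 whose y^j-derivative is [weyl4]. Naming it makes Euler's identity
    available for the index j, and its antisymmetry in p and l passes to [weyl4]. *)
Definition weyl3 (i p l : 'I_n) q : R :=
  3^-1 * (dy l (weyl F i p) q - dy p (weyl F i l) q).

Lemma weyl4E (j i p l : 'I_n) : weyl4 F j i p l = dy j (weyl3 i p l).
Proof. by []. Qed.

Lemma smooth_weyl3 (i p l : 'I_n) : smooth (weyl3 i p l).
Proof. by have sW := smooth_weyl; rewrite /weyl3; smooth_tac. Qed.

Lemma hom_weyl3 (i p l : 'I_n) : hom 1 (weyl3 i p l).
Proof.
apply: homZ; apply: homB.
- exact: (hom_dy openU coneU l (@smooth_weyl i p) (@hom_weyl i p)).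
- exact: (hom_dy openU coneU p (@smooth_weyl i l) (@hom_weyl i l)).
Qed.

Lemma smooth_weyl4 (j i p l : 'I_n) : smooth (weyl4 F j i p l).
Proof. by rewrite weyl4E; exact/smooth_dy/smooth_weyl3. Qed.

Lemma hom_weyl4 (j i p l : 'I_n) : hom 0 (weyl4 F j i p l).
Proof.
rewrite weyl4E.
exact: (hom_dy openU coneU j (@smooth_weyl3 i p l) (@hom_weyl3 i p l)).
Qed.

Lemma smooth_weakly_weyl j i k l : smooth (weakly_weyl F j i k l).
Proof. by have sW := smooth_weyl4; rewrite /weakly_weyl; smooth_tac. Qed.

Lemma hom_weakly_weyl j i k l : hom 0 (weakly_weyl F j i k l).
Proof.
apply: hom_sum => p.
exact: (hom_dy0M openU coneU k (@smooth_weyl4 j i p l) (@hom_weyl4 j i p l)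
  (@hom_ycoord _ _ _ p)).
Qed.

Lemma sum_mulr_exchange (a : 'I_n -> 'I_n -> R) (y z : 'I_n -> R) :
  \sum_(k < n) (\sum_(p < n) a p k * y p) * z k =
  \sum_(p < n) y p * (\sum_(k < n) a p k * z k).
Proof.
under eq_bigr do rewrite mulr_suml; rewrite exchange_big /=.
by apply: eq_bigr => p _; rewrite mulr_sumr; apply: eq_bigr => k _; ring.
Qed.

(** Here [weyl4] is the y^j-derivative of a function of degree 1, so [sum_dydy] kills the
    contraction over j for each p. *)
Lemma weakly_weyl_contract_j i k l q : U q ->
  \sum_(j < n) weakly_weyl F j i k l q * ycoord j q = 0.
Proof.
move=> Uq.
rewrite (sum_mulr_exchange (fun p j : 'I_n => dy k (weyl4 F j i p l) q)
  (fun a => ycoord a q) (fun a => ycoord a q)).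
apply: big1 => p _.
by rewrite (sum_dydy k (@smooth_weyl3 i p l) (@hom_weyl3 i p l) Uq) mulr0.
Qed.

(** The index k is a y-derivative of [weyl4], which has degree 0, so Euler's identity gives zero. *)
Lemma weakly_weyl_contract_k j i l q : U q ->
  \sum_(k < n) weakly_weyl F j i k l q * ycoord k q = 0.
Proof.
move=> Uq.
rewrite (sum_mulr_exchange (fun p k : 'I_n => dy k (weyl4 F j i p l) q)
  (fun a => ycoord a q) (fun a => ycoord a q)).
apply: big1 => p _.
by rewrite (euler (@smooth_weyl4 j i p l) (@hom_weyl4 j i p l) Uq) mul0r mulr0.
Qed.

Lemma weyl4_antisym (j i p l : 'I_n) q : U q -> weyl4 F j i p l q = - weyl4 F j i l p q.
Proof.
move=> Uq; rewrite !weyl4E -dyN //; last exact: smooth_weyl3.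
by apply: dy_eq_on => // z _; rewrite /weyl3 -mulrN opprB.
Qed.

(** Both p and l are then contracted with y, while [weyl4] is antisymmetric in them; the double sum
    equals its own opposite. *)
Lemma weakly_weyl_contract_l j i k q : U q ->
  \sum_(l < n) weakly_weyl F j i k l q * ycoord l q = 0.
Proof.
move=> Uq.
set S := \sum_(l < n) _.
have SN : S = - S.
  rewrite {1}/S (sum_mulr_exchange (fun p l : 'I_n => dy k (weyl4 F j i p l) q)
    (fun a => ycoord a q) (fun a => ycoord a q)) -sumrN; apply: eq_bigr => p _.
  rewrite -mulNr mulrC; congr (_ * _); rewrite -sumrN; apply: eq_bigr => l _.
  rewrite -mulNr; congr (_ * _); rewrite -dyN //; last exact: smooth_weyl4.
  by apply: dy_eq_on => // z Uz; rewrite weyl4_antisym.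
have : S *+ 2 == 0 by rewrite mulr2n {1}SN addNr.
by rewrite mulrn_eq0 /= => /eqP.
Qed.

Lemma sum_dy_weakly_weyl j i k l q : U q ->
  \sum_(r < n) dy r (weakly_weyl F j i k l) q * ycoord r q = 0.
Proof.
move=> Uq.
by rewrite (euler (@smooth_weakly_weyl j i k l) (@hom_weakly_weyl j i k l) Uq) mul0r.
Qed.

End Curvature.

(** * Projective invariance of the Weyl curvatures and change of the Berwald derivative *)

Section WeylInvariance.
Variables (F Fb P : coordTM R n -> R).
Hypotheses (sB : forall i, smooth (spray Fb i)) (hB : forall i, hom 2 (spray Fb i)).
Hypotheses (sP : smooth P) (hP : hom 1 P).
Hypothesis GE : forall i p, U p -> spray F i p = spray Fb i p + P p * ycoord i p.
Hypothesis n_ge2 : (2 <= n)%N.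
Local Notation Xi := (curvature_shift (spray Fb) P).
Local Notation tau := (curvature_tau (spray Fb) P).

Lemma riemann_change i k p : U p ->
  riemann F i k p = riemann Fb i k p + Xi p * (i == k)%:R + tau k p * ycoord i p.
Proof. by move=> Up; rewrite !riemannE; exact: riemann_projective. Qed.

Lemma scalarR_change p : U p -> scalarR F p = scalarR Fb p + Xi p.
Proof.
move=> Up; have n1 : n%:R - 1 != 0 :> R by rewrite subr_eq0 pnatr_eq1 gtn_eqF.
(* The trace adds n Xi + tau_m y^m = (n - 1) Xi, and n >= 2 makes n - 1 invertible. *)
have E : \sum_(m < n) riemann F m m p =
    \sum_(m < n) riemann Fb m m p + (n%:R - 1) * Xi p.
  transitivity (\sum_(m < n) (riemann Fb m m p + Xi p + tau m p * ycoord m p)).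
    by apply: eq_bigr => m _; apply: etrans (riemann_change m m Up) _;
      rewrite eqxx mulr1.
  rewrite big_split /= [X in _ + X](tau_y sB hB sP hP Up) big_split /=.
  rewrite sumr_const card_ord -addrA; congr (_ + _).
  by rewrite mulrBl mul1r mulr_natl.
apply: etrans (congr1 (fun s => (n%:R - 1)^-1 * s) E) _.
by rewrite mulrDr mulKf.
Qed.

Lemma tensorA_change i k p : U p ->
  tensorA F i k p = tensorA Fb i k p + tau k p * ycoord i p.
Proof.
move=> Up; rewrite /tensorA riemann_change // scalarR_change //.
by move: (riemann _ _ _ _) (scalarR _ _) (Xi _) (tau _ _ * _) => a b c d; ring.
Qed.

Lemma weyl_change i k p : U p -> weyl F i k p = weyl Fb i k p.
Proof.
move=> Up; have st := smooth_tau sB sP; have sA := smooth_tensorA sB.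
(* The divergence of tau_k y^m is tau_k.m y^m + n tau_k, that is (n + 1) tau_k because tau_k has
   degree 1. The factor 1/(n + 1) in [weyl] then removes exactly the term tau_k y^i of A^i_k. *)
have E : \sum_(m < n) dy m (tensorA F m k) p =
    \sum_(m < n) dy m (tensorA Fb m k) p + (n%:R + 1) * tau k p.
  transitivity (\sum_(m < n) (dy m (tensorA Fb m k) p +
      (dy m (tau k) p * ycoord m p + tau k p))).
    apply: eq_bigr => m _.
    apply: etrans (dy_eq_on m (fun q Uq => tensorA_change m k Uq) Up) _.
    have sty : smooth (fun q => tau k q * ycoord m q).
      by apply: (smoothM openU) => //; exact: smooth_ycoord.
    by rewrite (dyD m (sA m k) sty Up) (dyMy m m (st k) Up) eqxx mulr1.
  rewrite big_split /= [X in _ + X]big_split /=.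
  rewrite [X in _ + (X + _)](euler (st k) (hom_tau sB hB sP hP k) Up) mul1r.
  by rewrite sumr_const card_ord mulrDl mul1r mulr_natl [tau k p + _]addrC.
apply: etrans (congr2 (fun a s => a - (n%:R + 1)^-1 * s * ycoord i p)
  (tensorA_change i k Up) E) _.
have n1 : n%:R + 1 != 0 :> R by rewrite natr1 pnatr_eq0.
by rewrite /weyl mulrDr mulKf // mulrDl opprD addrACA subrr addr0.
Qed.

Lemma weyl4_change (j i p l : 'I_n) q : U q -> weyl4 F j i p l q = weyl4 Fb j i p l q.
Proof.
apply: dy_eq_on => z Uz; apply: (congr2 (fun a b => 3^-1 * (a - b))).
- exact: (dy_eq_on l (fun w => @weyl_change i p w) Uz).
- exact: (dy_eq_on p (fun w => @weyl_change i l w) Uz).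
Qed.

Lemma weakly_weyl_change j i k l q : U q ->
  weakly_weyl F j i k l q = weakly_weyl Fb j i k l q.
Proof.
move=> Uq; apply: eq_bigr => p _; apply: (congr1 (fun a => a * ycoord p q)).
exact: (dy_eq_on k (fun w => @weyl4_change j i p l w) Uq).
Qed.

Lemma hcov0E f (T : 'I_n -> 'I_n -> 'I_n -> 'I_n -> coordTM R n -> R) j i k l q :
  hcov0 f T j i k l q =
  hcov0_value (fun a => ycoord a q) (fun r m => dy m (spray f r) q)
    (fun i r m => dy m (dy r (spray f i)) q) (fun m => dx m (T j i k l) q)
    (fun r => dy r (T j i k l) q) (fun j i k l => T j i k l q) j i k l.
Proof. by []. Qed.

(** The pointwise formula is applied to the tensor of [Fb]. The tensor of [F] coincides with it on
    the open set [U], hence so do its partial derivatives. *)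
Lemma hcov0_weakly_weyl_change j i k l q : U q ->
  hcov0 F (weakly_weyl F) j i k l q =
  hcov0 Fb (weakly_weyl Fb) j i k l q - 2 * P q * weakly_weyl Fb j i k l q
  + (\sum_(r < n) dy r P q * weakly_weyl Fb j r k l q) * ycoord i q.
Proof.
move=> Uq; rewrite !hcov0E.
have T1 := weakly_weyl_contract_j sB hB i k l Uq.
have T3 := weakly_weyl_contract_k sB hB j i l Uq.
have T4 := weakly_weyl_contract_l sB j i k Uq.
have T0 := sum_dy_weakly_weyl sB hB j i k l Uq.
have P0 r := euler_dyP sP hP r Uq.
apply: etrans (@hcov0_value_projective R n (fun a => ycoord a q)
  (fun r m => dy m (spray Fb r) q) (fun i r m => dy m (dy r (spray Fb i)) q)
  (fun m => dx m (weakly_weyl Fb j i k l) q) (fun r => dy r (weakly_weyl Fb j i k l) q)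
  (fun j i k l => weakly_weyl Fb j i k l q) (P q) (fun m => dy m P q)
  (fun m r => dy m (dy r P) q) j i k l (euler_P sP hP Uq) P0 T0 T1 T3 T4).
apply: eq_hcov0_value => [r m|a r m|m|r|a b c d].
- exact: dy_spray.
- exact: dydy_spray.
- exact: (dx_eq_on m (fun w => @weakly_weyl_change j i k l w) Uq).
- exact: (dy_eq_on r (fun w => @weakly_weyl_change j i k l w) Uq).
- exact: weakly_weyl_change.
Qed.

End WeylInvariance.
End Sprays.

(** * Charts and Finsler metrics *)

Section Charts.
Context (R : realType) (n : nat) (M : topologicalType) (A : smooth_atlas R n M).
Implicit Types (c d : chart A) (p : coordTM R n).

Lemma open_slit c : open (slit c).
Proof.
have -> : slit c = fst @^-1` (phi c @` dom c) `&` snd @^-1` (~` [set 0]).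
  by apply/seteqP; split => p [? /eqP].
apply: openI.
  by apply: open_comp; [move=> p _; exact: cvg_fst|exact: img_open].
apply: open_comp; first by move=> p _; exact: cvg_snd.
exact/closed_openC/accessible_closed_set1/hausdorff_accessible/norm_hausdorff.
Qed.

Lemma cone_slit c : cone (slit c).
Proof. by move=> p t [cp p0] t0; split => //=; rewrite scaler_eq0 negb_or gt_eqF. Qed.

(** Points near [phi c m] lie in the image of [dom c], and continuity of [psi c] sends them into the
    open set [dom d]. *)
Lemma open_overlap c d : open (phi c @` (dom c `&` dom d)).
Proof.
rewrite openE => _ [m [cm dm] <-].
have cx : (phi c @` dom c) (phi c m) by exists m.
have : \forall x \near phi c m, dom d (psi c x).
  apply: (psi_continuous cx); rewrite phiK //.
  by apply: open_nbhs_nbhs; split => //; exact: dom_open.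
have : \forall x \near phi c m, (phi c @` dom c) x.
  by apply: open_nbhs_nbhs; split => //; exact: img_open.
apply: filterS2 => _ [m' cm' <-]; rewrite phiK // => dm'.
by exists m'.
Qed.

Lemma transition_differentiable c d x :
  (phi c @` (dom c `&` dom d)) x -> differentiable (transition c d) x.
Proof. by move=> cdx; have [+ _] := @transition_smooth _ _ _ A c d 1; exact. Qed.

Lemma transition_overlap c d x : (phi c @` (dom c `&` dom d)) x ->
  (phi d @` (dom d `&` dom c)) (transition c d x).
Proof. by move=> [m [cm dm] <-]; exists m => //; rewrite /transition /= phiK. Qed.

Lemma transitionK c d x : (phi c @` (dom c `&` dom d)) x ->
  transition d c (transition c d x) = x.
Proof. by move=> [m [cm dm] <-]; rewrite /transition /= !phiK. Qed.

(* The differential of a transition map is injective, the reverse transition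
   map being a left inverse. *)
Lemma derive_transition_neq0 c d x v : (phi c @` (dom c `&` dom d)) x ->
  v != 0 -> 'D_v (transition c d) x != 0.
Proof.
move=> cdx; apply: contra_neq => Dv0.
have dcd := transition_differentiable cdx.
have ddc := transition_differentiable (transition_overlap cdx).
transitivity ('D_v (transition d c \o transition c d) x).
  rewrite (derive_eq_on (@open_overlap c d) (g := id)) ?derive_id // => y.
  exact: transitionK.
rewrite deriveE; last exact: differentiable_comp.
have e : 'd (transition c d) x v = 0 by rewrite -(deriveE _ dcd).
rewrite (diff_comp dcd ddc).
apply: etrans (congr1 ('d (transition d c) (transition c d x)) e) _.
exact: linear0.
Qed.

Lemma change_slit c d p : slit c p -> overlap c d p -> slit d (change c d p).
Proof.
move=> [_ p0] cdp; split; last exact: derive_transition_neq0.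
by have [m [dm _] e] := transition_overlap cdp; exists m.
Qed.

(** Over a fixed base point the change of coordinates is linear in y, so it maps the line in the
    direction of the r-th vertical vector to a line directed by row r of [jac]. Expanding the
    derivative in that direction gives the covector law. *)
Lemma dy_covector (f : chart A -> coordTM R n -> R) :
  scalar_on_slit f -> smooth_on_slit f -> covector_on_slit (fun c r => dy r (f c)).
Proof.
move=> scf smf c d p cp cdp r.
have dT := transition_differentiable cdp.
have dfd := smooth_differentiable (smf d) (change_slit cp cdp).
pose v := 'D_(delta_mx 0 r) (transition c d) p.1.
(* The scalar law holds only over the overlap, so it can be differentiated once this set is known to
   be open. *)
have oU : open (slit c `&` overlap c d).
  apply: openI; first exact: open_slit.
  by apply: open_comp; [move=> q _; exact: cvg_fst|exact: open_overlap].
rewrite {1}/dy (derive_eq_on oU (g := fun q => f d (change c d q))) //; last first.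
  by move=> q [cq cdq]; rewrite scf.
rewrite (@eq_derive_along _ _ _ _ _ (f d) p _ (change c d p) (0, v)); last first.
  move=> h; congr (f d _); rewrite /change.
  congr pair; rewrite /= scaler0 !add0r // !deriveE //.
  by rewrite linearP /v deriveE.
rewrite derive_vertical // [X in X + _](_ : _ = 0) ?add0r; last first.
  by rewrite (_ : (0, 0) = 0 :> coordTM R n) // derive0.
by [].
Qed.

End Charts.

(** * Nondegeneracy, positivity and smoothness for Finsler metrics *)

Section FinslerMetrics.
Context (R : realType) (n : nat) (M : topologicalType) (A : smooth_atlas R n M).
Implicit Types (F Fb : finsler_metric A) (c : chart A).

Lemma hom_metric F c : homogeneous (slit c) 1 (F c).
Proof.
move=> [x y] t [cp _] t0; rewrite expr1; exact: metric_homogeneous.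
Qed.

(** A nonzero v with v g = 0 would give v g v^T = 0, against positive definiteness. *)
Lemma fundamental_unit F c p : slit c p -> fundamental (F c) p \in unitmx.
Proof.
move=> cp; rewrite -row_free_unit -kermx_eq0; apply: contraT => /rowV0Pn[v].
rewrite sub_kermx => /eqP v0 vn0; have := metric_convex F cp vn0.
by rewrite v0 mul0mx mxE ltxx.
Qed.

(** On nonzero vectors F^2 = g_ij y^i y^j is positive by convexity, which upgrades F >= 0 to the
    strict inequality required to divide by F. *)
Lemma metric_gt0 F c p : slit c p -> 0 < F c p.
Proof.
move=> cp; rewrite lt0r; apply/andP; split; last by apply: metric_ge0; case: cp.
rewrite -sqrf_eq0 -(fundamental_diag (open_slit (c := c)) (@cone_slit _ _ _ _ c)
  (@metric_smooth _ _ _ _ F c) (@hom_metric F c) cp).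
by rewrite gt_eqF // metric_convex //; case: cp.
Qed.

Lemma smooth_metric_spray F c i : smooth_on (slit c) (spray (F c) i).
Proof.
apply: (smooth_spray (open_slit (c := c))); first exact: metric_smooth.
by move=> p; exact: fundamental_unit.
Qed.

Lemma hom_metric_spray F c i : homogeneous (slit c) 2 (spray (F c) i).
Proof.
apply: (hom_spray (open_slit (c := c)) (@cone_slit _ _ _ _ c)).
- exact: metric_smooth.
- exact: hom_metric.
Qed.

Lemma sum_ycoord2_neq0 c p : slit c p -> \sum_(i < n) ycoord i p ^+ 2 != 0.
Proof.
move=> [_]; apply: contra_neq => /eqP.
rewrite psumr_eq0 => [/allP y0|i _]; last exact: sqr_ge0.
apply/rowP => i; rewrite mxE; apply/eqP; rewrite -sqrf_eq0.
by apply: (y0 i); rewrite mem_index_enum.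
Qed.

(** Projective equivalence provides P without regularity. Contracting the spray relation with y in
    the chart recovers P as a quotient of smooth functions, with the Euclidean square norm of y as
    denominator. *)
Lemma smooth_projective_factor F Fb (P : chart A -> coordTM R n -> R) :
  (forall c p, slit c p -> forall i,
     spray (F c) i p = spray (Fb c) i p + P c p * ycoord i p) ->
  smooth_on_slit P.
Proof.
move=> GE c; have oU := @open_slit _ _ _ _ c.
have sy i : smooth_on (slit c) (@ycoord R n i) := @smooth_ycoord _ _ _ i.
apply: (eq_smooth oU (f := fun q =>
  (\sum_(i < n) (spray (F c) i q - spray (Fb c) i q) * ycoord i q) *
  (\sum_(i < n) ycoord i q ^+ 2)^-1)).
  move=> q cq; have y2 := sum_ycoord2_neq0 cq.
  have -> : \sum_(i < n) (spray (F c) i q - spray (Fb c) i q) * ycoord i q =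
      P c q * \sum_(i < n) ycoord i q ^+ 2.
    rewrite mulr_sumr; apply: eq_bigr => i _.
    by rewrite (GE c q cq i) addrC addKr expr2 mulrA.
  by rewrite mulfK.
apply: (smoothM oU).
  apply: (smooth_sum oU) => i; apply: (smoothM oU) => //.
  exact: (smoothB oU (@smooth_metric_spray F c i) (@smooth_metric_spray Fb c i)).
apply: (smoothV oU); first by move=> q; exact: sum_ycoord2_neq0.
by apply: (smooth_sum oU) => i; exact: (smoothX oU).
Qed.

End FinslerMetrics.

(** * Transfer of the generalized weakly-Weyl equation from [Fbar] to [F] *)

Theorem theorem2p2 (R : realType) (n : nat) (M : topologicalType)
    (A : smooth_atlas R n M) (F Fbar : finsler_metric A) :
  (2 <= n)%N -> hausdorff_space M -> @second_countable M ->
  projectively_equivalent F Fbar ->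
  generalized_weakly_weyl Fbar -> generalized_weakly_weyl F.
Proof.
move=> n_ge2 _ _ [P [scP hP GE]] [lam [mu [covl sml scmu smmu E]]].
have smP := smooth_projective_factor GE.
have hP1 c : homogeneous (slit c) 1 (P c).
  by move=> [x y] t cp t0; rewrite expr1; exact: hP.
have oU c := @open_slit _ _ _ A c.
exists (fun c r p => lam c r p + dy r (P c) p).
(* The product mu F has to absorb both mub Fb and the term -2 P T of the change of derivative; F is
   nonzero on the slit bundle. *)
exists (fun c p => (mu c p * Fbar c p + 2 * P c p) * (F c p)^-1); split.
- move=> c d p cp cdp r; rewrite (covl c d p cp cdp) (dy_covector scP smP cp cdp).
  by rewrite -big_split /=; apply: eq_bigr => s _; rewrite mulrDr.
- move=> r c; apply: (smoothD (oU c)); first exact: sml.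
  exact/smooth_derive/smP.
- move=> c d p cp cdp; have tp : tangent c p by case: cp.
  by rewrite scmu // scP // !metric_scalar.
- move=> c; apply: (smoothM (oU c)).
    apply: (smoothD (oU c)).
      by apply: (smoothM (oU c)); [exact: smmu|exact: metric_smooth].
    by apply: (smoothM (oU c)); [exact: smooth_cst|exact: smP].
  apply: (smoothV (oU c)); last exact: metric_smooth.
  by move=> q cq; rewrite gt_eqF // metric_gt0.
move=> c p cp j i k l.
have F0 : F c p != 0 by rewrite gt_eqF // metric_gt0.
have sB := @smooth_metric_spray _ _ _ _ Fbar c.
have hB := @hom_metric_spray _ _ _ _ Fbar c.
have GEc a q (cq : slit c q) := GE c q cq a.
have W a := weakly_weyl_change (oU c) (@cone_slit _ _ _ A c) sB hB (smP c) (hP1 c)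
  GEc n_ge2 j a k l cp.
rewrite mulfVK // (W i).
rewrite (hcov0_weakly_weyl_change (oU c) (@cone_slit _ _ _ A c) sB hB (smP c) (hP1 c)
  GEc n_ge2 j i k l cp).
transitivity (\sum_(r < n) (lam c r p * weakly_weyl (Fbar c) j r k l p * ycoord i p
    + dy r (P c) p * weakly_weyl (Fbar c) j r k l p * ycoord i p)); last first.
  by apply: eq_bigr => r _; rewrite (W r) !mulrDl.
(* The equation of [Fbar] replaces the sum with lambdab; afterwards the two terms 2 P T cancel and
   the terms in P_.r agree. *)
rewrite big_split /= -(E c p cp) -mulr_suml.
move: (hcov0 _ _ _ _ _ _ _) (weakly_weyl _ _ _ _ _ _) (\sum_(r < n) _) => h w s.
by ring.
Qed.
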